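(* Let $V$ be a real vector space of dimension $n$ and let $\mathfrak{B}$ be an $n$-dimensional Abelian Lie subalgebra of $\mathfrak{gl}(V)$. Suppose that the semidirect sum $\mathfrak{B}\ltimes V$ is a Frobenius Lie algebra. Then $\mathfrak{B}$ is a maximal Abelian subalgebra (MASA) of $\mathfrak{gl}(V)$, and the Lie group $U(\mathfrak{B})$ of invertible elements of $\mathfrak{B}$ is a maximal Abelian subgroup of $\mathrm{GL}(V)$. Conversely, every (finite-dimensional real) 2-solvable Frobenius Lie algebra is isomorphic to one of this form, i.e. to $\mathfrak{B}\ltimes V$ for some real vector space $V$ of some finite dimension $n$ and some $n$-dimensional Abelian Lie subalgebra $\mathfrak{B}$ of $\mathfrak{gl}(V)$ such that $\mathfrak{B}\ltimes V$ is Frobenius.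
   Context: $\mathfrak{gl}(V)$ is the Lie algebra of linear endomorphisms of $V$ and $\mathrm{GL}(V)$ the group of invertible ones. For an Abelian Lie subalgebra $\mathfrak{B}\subset\mathfrak{gl}(V)$, the semidirect sum $\mathfrak{B}\ltimes V$ is the vector space $\mathfrak{B}\oplus V$ with Lie bracket $[a,b]=0$, $[x,y]=0$, $[a,x]=ax=a(x)$ for $a,b\in\mathfrak{B}$, $x,y\in V$. A Lie algebra $\mathcal G$ is a Frobenius Lie algebra if there is $\alpha\in\mathcal G^*$ such that the bilinear form $\partial\alpha(u,v):=-\alpha([u,v])$ on $\mathcal G$ is nondegenerate. A Lie algebra is 2-solvable if its derived ideal $[\mathcal G,\mathcal G]$ is Abelian. A subalgebra $\mathcal A$ of a Lie algebra $\mathcal G$ is a MASA of $\mathcal G$ if it equals its own centralizer $\{a\in\mathcal G : [a,\mathcal A]=0\}$ in $\mathcal G$. $U(\mathfrak{B})$ is the set of elements of $\mathfrak{B}$ that are invertible as endomorphisms of $V$. *)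

(* Defs.v *)
From HB Require Import structures.
From mathcomp Require Import all_boot all_order all_algebra.
From mathcomp Require Import ssrAC reals.

Set Implicit Arguments.
Unset Strict Implicit.
Unset Printing Implicit Defensive.

Import GRing.Theory.
Local Open Scope ring_scope.

(* Lie algebras are finite-dimensional, since [vectType] is. *)
HB.mixin Record isLieAlgebra (R : fieldType) G of Vector R G := {
  lie : G -> G -> G;
  lie_bilinear : bilinear_for *:%R *:%R lie;
  liexx : forall x, lie x x = 0;
  lie_jacobi : forall x y z,
    lie x (lie y z) + lie y (lie z x) + lie z (lie x y) = 0
}.

#[short(type="lieAlgType")]
HB.structure Definition LieAlgebra (R : fieldType) :=
  {G of isLieAlgebra R G & Vector R G}.

Section LieAlgebraTheory.
Variables (R : fieldType) (G : lieAlgType R).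
Implicit Types (A B C : {vspace G}) (x y : G).

HB.instance Definition _ :=
  bilinear_isBilinear.Build R G G G *:%R *:%R (@lie R G) lie_bilinear.

Lemma lie_anti x y : lie x y = - lie y x.
Proof.
have := liexx (x + y).
rewrite linearDl /= !linearDr /= !liexx add0r addr0.
by move/eqP; rewrite addr_eq0 => /eqP.
Qed.

Definition lie_subalgebra A := {in A &, forall x y, lie x y \in A}.

Definition lie_abelian A := {in A &, forall x y, lie x y = 0}.

Definition abelian_subalgebra A := lie_subalgebra A /\ lie_abelian A.

Definition masa A :=
  lie_subalgebra A /\ (forall x, x \in A <-> {in A, forall y, lie x y = 0}).

(* The subspace spanned by all brackets [lie x y] with x in A and y in B. *)
Definition lie_prodv A B : {vspace G} :=
  <<[seq lie x y | x <- vbasis A, y <- vbasis B]>>%VS.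

Lemma lie_prodvP A B C :
  reflect {in A & B, forall x y, lie x y \in C} (lie_prodv A B <= C)%VS.
Proof.
apply: (iffP span_subvP) => [sAB x y Ax By | sAB _ /allpairsP[[x y] /= [Ax By ->]]].
  rewrite (coord_vbasis Ax) (coord_vbasis By) linear_sumlz memv_suml // => i _.
  rewrite linear_sumr memv_suml // => j _.
  rewrite linearZr linearZl_LR /= !memvZ // sAB //.
  by apply/allpairsP; exists ((vbasis A)`_i, (vbasis B)`_j); split;
    rewrite //= mem_nth // size_tuple.
exact: sAB (vbasis_mem Ax) (vbasis_mem By).
Qed.

Definition derived_ideal : {vspace G} := lie_prodv fullv fullv.

End LieAlgebraTheory.

Definition two_solvable (R : fieldType) (G : lieAlgType R) :=
  lie_abelian (derived_ideal G).

Section Frobenius.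
Variables (R : fieldType) (G : lieAlgType R).

Definition coboundary (alpha : 'Hom(G, R^o)) (u v : G) : R := - alpha (lie u v).

Variable alpha : 'Hom(G, R^o).

Fact coboundary_bilinear :
  bilinear_for *%R (idfun \; *%R) (coboundary alpha).
Proof.
split=> [v a x y | u a x y]; rewrite /coboundary /=.
  by rewrite linearPl linearP opprD -mulrN.
by rewrite linearPr linearP opprD -mulrN.
Qed.

HB.instance Definition _ := bilinear_isBilinear.Build R G G R
  *%R (idfun \; *%R) (coboundary alpha) coboundary_bilinear.

Fact coboundary_skew u v :
  coboundary alpha u v = (-1) ^+ true * idfun (coboundary alpha v u).
Proof. by rewrite /coboundary /= lie_anti linearN expr1 mulN1r. Qed.

HB.instance Definition _ := isHermitianSesquilinear.Build R G true idfun
  (coboundary alpha) coboundary_skew.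

End Frobenius.

Definition frobenius (R : fieldType) (G : lieAlgType R) :=
  exists alpha : 'Hom(G, R^o), nondegenerate (coboundary alpha).

Definition lie_isomorphic (R : fieldType) (G H : lieAlgType R) :=
  exists f : {linear G -> H},
    bijective f /\ {morph f : x y / lie x y >-> lie x y}.

Section GeneralLinear.
Variables (R : fieldType) (V : vectType R).

Definition comm_lfun (a b : 'End(V)) : 'End(V) := ((a \o b) - (b \o a))%VF.

Lemma comm_lfunE a b x : comm_lfun a b x = a (b x) - b (a x).
Proof. by rewrite /comm_lfun add_lfunE opp_lfunE !comp_lfunE. Qed.

Fact comm_lfun_bilinear : bilinear_for *:%R *:%R comm_lfun.
Proof.
split=> [b k a c | a k b c]; apply/lfunP=> x;
  rewrite [RHS]add_lfunE scale_lfunE !comm_lfunE !add_lfunE !scale_lfunE linearP;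
  by rewrite scalerBr opprD addrACA.
Qed.

Fact comm_lfunxx a : comm_lfun a a = 0.
Proof. exact: subrr. Qed.

Fact comm_lfun_jacobi a b c :
  comm_lfun a (comm_lfun b c) + comm_lfun b (comm_lfun c a)
    + comm_lfun c (comm_lfun a b) = 0.
Proof.
apply/lfunP=> x; rewrite 2!add_lfunE zero_lfunE !comm_lfunE !linearB /=.
rewrite !opprK !addrA.
rewrite [LHS](ACl ((1*11)*(2*8)*(3*5)*(4*10)*(6*12)*(7*9)))%AC /=.
by rewrite !(subrr, addNr, addr0).
Qed.

HB.instance Definition _ := isLieAlgebra.Build R 'End(V)
  comm_lfun_bilinear comm_lfunxx comm_lfun_jacobi.

(* [f^-1] is total: for a non-invertible f it is only a partial inverse. *)
Definition invertible_lfun : pred 'End(V) :=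
  [pred f | (f \o f^-1 == \1)%VF && (f^-1 \o f == \1)%VF].

Lemma invertible_lfunP f :
  reflect (exists g, (f \o g = \1)%VF /\ (g \o f = \1)%VF) (invertible_lfun f).
Proof.
apply: (iffP andP) => [[/eqP fV /eqP Vf] | [g [fg gf]]]; first by exists f^-1%VF.
have kerf : lker f == 0%VS.
  apply/lker0P=> x y fxy.
  by rewrite -[x]id_lfunE -[y]id_lfunE -gf !comp_lfunE fxy.
by rewrite lker0_compfV // lker0_compVf.
Qed.

Record lfunGL := LfunGL {
  lfunGL_val :> 'End(V);
  lfunGL_subproof : invertible_lfun lfunGL_val
}.

HB.instance Definition _ := [isSub for lfunGL_val].
HB.instance Definition _ := [Choice of lfunGL by <:].

Fact lfunGL1_proof : invertible_lfun \1%VF.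
Proof. by apply/invertible_lfunP; exists \1%VF; rewrite comp_lfun1l. Qed.
Fact lfunGLV_proof (f : lfunGL) : invertible_lfun (f^-1)%VF.
Proof.
by case/andP: (lfunGL_subproof f) => /eqP fV /eqP Vf; apply/invertible_lfunP; exists f.
Qed.
Fact lfunGLM_proof (f g : lfunGL) : invertible_lfun (f \o g)%VF.
Proof.
case/invertible_lfunP: (lfunGL_subproof f) => f' [ff' f'f].
case/invertible_lfunP: (lfunGL_subproof g) => g' [gg' g'g].
apply/invertible_lfunP; exists (g' \o f')%VF.
split; rewrite comp_lfunA.
  by rewrite -(comp_lfunA _ _ g') gg' comp_lfun1r.
by rewrite -(comp_lfunA _ f') f'f comp_lfun1r.
Qed.

Definition lfunGL_one : lfunGL := LfunGL lfunGL1_proof.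
Definition lfunGL_inv (f : lfunGL) : lfunGL := LfunGL (lfunGLV_proof f).
Definition lfunGL_mul (f g : lfunGL) : lfunGL := LfunGL (lfunGLM_proof f g).

Fact lfunGL_mulA : associative lfunGL_mul.
Proof. by move=> f g h; apply/val_inj/comp_lfunA. Qed.
Fact lfunGL_mul1g : left_id lfunGL_one lfunGL_mul.
Proof. by move=> f; apply/val_inj/comp_lfun1l. Qed.
Fact lfunGL_mulg1 : right_id lfunGL_one lfunGL_mul.
Proof. by move=> f; apply/val_inj/comp_lfun1r. Qed.
Fact lfunGL_mulVg : left_inverse lfunGL_one lfunGL_inv lfunGL_mul.
Proof. by move=> f; apply/val_inj; case/andP: (lfunGL_subproof f) => _ /eqP. Qed.
Fact lfunGL_mulgV : right_inverse lfunGL_one lfunGL_inv lfunGL_mul.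
Proof. by move=> f; apply/val_inj; case/andP: (lfunGL_subproof f) => /eqP. Qed.

HB.instance Definition _ := isGroup.Build lfunGL
  lfunGL_mulA lfunGL_mul1g lfunGL_mulg1 lfunGL_mulVg lfunGL_mulgV.

Definition units_of (B : {vspace 'End(V)}) : {pred lfunGL} :=
  [pred g : lfunGL | lfunGL_val g \in B].

End GeneralLinear.

Definition abelian_subgroup (G : groupType) (S : {pred G}) :=
  group_closed S /\ {in S &, forall x y, commute x y}.

Definition maximal_abelian_subgroup (G : groupType) (S : {pred G}) :=
  abelian_subgroup S /\
  forall T : {pred G}, abelian_subgroup T -> {subset S <= T} -> T =i S.

Section SemidirectSum.
Variables (R : fieldType) (V : vectType R) (B : {vspace 'End(V)}).

(* The proof that B is Abelian is a parameter of the type because the Jacobi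
   identity of the bracket depends on it. *)
Definition semidirect_sum of abelian_subalgebra B : Type := (subvs_of B * V)%type.

Hypothesis abB : abelian_subalgebra B.
Local Notation BV := (semidirect_sum abB).

HB.instance Definition _ := Vector.on BV.

Definition semidirect_lie (u v : BV) : BV :=
  (0, vsval u.1 v.2 - vsval v.1 u.2).

Fact semidirect_lie_bilinear : bilinear_for *:%R *:%R semidirect_lie.
Proof.
split=> [v k u w | u k v w]; congr pair; rewrite /= ?scaler0 ?addr0 //;
  by rewrite !linearP /= add_lfunE scale_lfunE scalerBr ?scalerN ?opprD addrACA.
Qed.

Fact semidirect_liexx u : semidirect_lie u u = 0.
Proof. by rewrite /semidirect_lie subrr. Qed.

Fact semidirect_lie_jacobi u v w :
  semidirect_lie u (semidirect_lie v w) + semidirect_lie v (semidirect_lie w u)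
    + semidirect_lie w (semidirect_lie u v) = 0.
Proof.
have abC (a b : subvs_of B) x : vsval a (vsval b x) = vsval b (vsval a x).
  have /lfunP/(_ x) := abB.2 _ _ (subvsP a) (subvsP b).
  by rewrite comm_lfunE zero_lfunE => /eqP; rewrite subr_eq0 => /eqP.
have lie2 a b c : semidirect_lie a (semidirect_lie b c) =
    (0, vsval a.1 (vsval b.1 c.2) - vsval a.1 (vsval c.1 b.2)).
  by rewrite /semidirect_lie /= zero_lfunE subr0 linearB.
rewrite !lie2; congr pair; rewrite /= ?addr0 //.
rewrite (abC w.1 u.1) (abC v.1 u.1) (abC w.1 v.1) !addrA.
rewrite [LHS](ACl ((1*4)*(2*5)*(3*6)))%AC /=.
by rewrite !(subrr, addNr, addr0).
Qed.

HB.instance Definition _ := isLieAlgebra.Build R BV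
  semidirect_lie_bilinear semidirect_liexx semidirect_lie_jacobi.

End SemidirectSum.

(* Main.v *)
(* Direct part: write f for the restriction of the Frobenius functional to V.
   Nondegeneracy says that (b, y) |-> f (b y) is a perfect pairing of B and V.
   If c commutes with B, choose b in B with f (b _) = f (c _); then
   f (a ((c - b) y)) = f ((c - b) (a y)) = 0 for all a in B, so c = b. Units of
   B span B, because b - t is invertible for some scalar t; hence what commutes
   with the units commutes with B.
   Converse: let D = [G, G], and let e be the principal element of the Frobenius
   functional alpha, alpha [e, _] = alpha. As D is Abelian, ad e commutes on D
   with every ad a, so alpha [a, [e, x] - x] = 0 for x in D, i.e. ad e is a
   projection of G onto D. The isomorphism is then u |-> (ad u on D, [e, u]). *)

Require Import Defs.
From HB Require Import structures.
From mathcomp Require Import all_boot all_order all_algebra.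
From mathcomp Require Import reals.

Set Implicit Arguments.
Unset Strict Implicit.
Unset Printing Implicit Defensive.

Local Open Scope ring_scope.

Import GRing.Theory Num.Theory passmx.

(** * Pairings injective on one side *)

Section Pairing.
Variables (R : fieldType) (U W : vectType R) (h : U -> W -> R^o).
Hypotheses (h_bilin : bilinear_for *:%R *:%R h)
           (h_inj : forall u, (forall w, h u w = 0) -> u = 0).

Let h_row (u : U) : {linear W -> R^o} :=
  HB.pack (h u) (GRing.isLinear.Build R W R^o *:%R (h u) (h_bilin.2 u)).

Let h_lfun (u : U) : 'Hom(W, R^o) := linfun (h_row u).

Let h_lfun_linear : linear h_lfun.
Proof.
move=> a u v; apply/lfunP=> w.
by rewrite add_lfunE scale_lfunE !lfunE /=; apply: h_bilin.1.
Qed.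

Let h_lin : {linear U -> 'Hom(W, R^o)} :=
  HB.pack h_lfun
    (GRing.isLinear.Build R U 'Hom(W, R^o) *:%R h_lfun h_lfun_linear).

Let h_lin_ker : lker (linfun h_lin) == 0%VS.
Proof.
rewrite -subv0; apply/subvP=> u; rewrite memv_ker lfunE /= memv0 => /eqP hu0.
apply/eqP/h_inj=> w.
by have := lfunE (h_row u) w; rewrite -/(h_lfun u) hu0 zero_lfunE.
Qed.

Let dim_img : \dim (limg (linfun h_lin)) = \dim {:U}.
Proof. by rewrite limg_dim_eq // (eqP h_lin_ker) capv0. Qed.

(** [u |-> h u] embeds [U] into the dual of [W], which has the dimension of [W]. *)
Lemma pairing_dim_le : (\dim {:U} <= \dim {:W})%N.
Proof.
rewrite -dim_img (leq_trans (dimvS (subvf _))) // !dimvf.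
by rewrite /dim /= muln1.
Qed.

(** With equal dimensions the embedding of [U] fills the whole dual of [W]. *)
Lemma pairing_represent (g : W -> R^o) :
  \dim {:U} = \dim {:W} -> linear g -> exists u, h u =1 g.
Proof.
move=> dimUW g_lin.
pose G : {linear W -> R^o} :=
  HB.pack g (GRing.isLinear.Build R W R^o *:%R g g_lin).
have limT : limg (linfun h_lin) = fullv.
  apply/eqP; rewrite eqEdim subvf dim_img dimUW !dimvf /=.
  by rewrite {1}/dim /= muln1.
have : linfun G \in limg (linfun h_lin) by rewrite limT memvf.
case/memv_imgP=> u _; rewrite lfunE /= => eqGu; exists u => w.
have := congr1 (fun f : 'Hom(W, R^o) => f w) eqGu.
by rewrite (lfunE G) (lfunE (h_row u)) => /esym.
Qed.

End Pairing.

(** * Frobenius functionals *)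

Section FrobeniusTheory.
Variables (R : fieldType) (G : lieAlgType R).
Implicit Type alpha : 'Hom(G, R^o).

Lemma coboundary_nondegenerateP alpha :
  nondegenerate (coboundary alpha)
    <-> forall u, (forall v, alpha (lie u v) = 0) -> u = 0.
Proof.
split=> [/eqP rad0 u u0 | inj0].
  apply/eqP; rewrite -memv0 -rad0; apply/mem_orthovP => v _.
  by rewrite /= /coboundary u0 oppr0.
rewrite /nondegenerate -subv0; apply/subvP=> u /mem_orthovP u0.
rewrite memv0; apply/eqP/inj0=> v.
by apply/eqP; rewrite -oppr_eq0; apply/eqP/u0; rewrite memvf.
Qed.

Lemma lie_form_bilinear alpha :
  bilinear_for *:%R *:%R (fun u v => alpha (lie u v)).
Proof.
by split=> [v a x y | u a x y]; rewrite /= ?linearPl ?linearPr linearP.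
Qed.

(** Nondegeneracy identifies [G] with its dual; for [g = alpha] the element [e] is the principal
    element. *)
Lemma frobenius_represent alpha (g : G -> R^o) :
  nondegenerate (coboundary alpha) -> linear g ->
  exists e, forall x, alpha (lie e x) = g x.
Proof.
move=> /coboundary_nondegenerateP nd g_lin.
exact: (pairing_represent (lie_form_bilinear alpha) nd erefl g_lin).
Qed.

End FrobeniusTheory.

(** The functional is transported along the inverse. In the converse this makes the constructed
    semidirect sum Frobenius. *)
Lemma frobenius_iso (R : fieldType) (G H : lieAlgType R) :
  lie_isomorphic G H -> frobenius G -> frobenius H.
Proof.
move=> [f [[g fK gK] f_lie]] [alpha /coboundary_nondegenerateP nd].
pose gL : {linear H -> G} :=
  HB.pack g (GRing.isLinear.Build R H G *:%R g (can2_linear fK gK)).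
exists (alpha \o linfun gL)%VF; apply/coboundary_nondegenerateP => u u0.
rewrite -[u]gK (nd (g u)) ?linear0 // => v.
have := u0 (f v); rewrite comp_lfunE lfunE /=.
by rewrite -{1}[u]gK -f_lie fK.
Qed.

(** * Commuting endomorphisms *)

Section EndomorphismCommutator.
Variables (R : fieldType) (V : vectType R).
Implicit Types a b : 'End(V).

Lemma lie_lfunE a b x : lie a b x = a (b x) - b (a x).
Proof. exact: comm_lfunE. Qed.

Lemma lie_lfun0P a b : lie a b = 0 <-> forall x, a (b x) = b (a x).
Proof.
split=> [ab0 x | abC].
  by apply/eqP; rewrite -subr_eq0 -lie_lfunE ab0 zero_lfunE.
by apply/lfunP=> x; rewrite lie_lfunE abC subrr zero_lfunE.
Qed.

End EndomorphismCommutator.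

(** * The perfect pairing of B and V *)

Section SemidirectPairing.
Variables (R : fieldType) (V : vectType R) (B : {vspace 'End(V)}).
Hypothesis abB : abelian_subalgebra B.
Variable alpha : 'Hom(semidirect_sum abB, R^o).
Hypothesis nd_alpha : nondegenerate (coboundary alpha).

(** The value of [alpha] on the bracket of [(b, 0)] and [(0, y)]. *)
Definition semidirect_form (b : subvs_of B) (y : V) : R^o :=
  alpha ((0, vsval b y) : semidirect_sum abB).

Lemma semidirect_form_bilinear : bilinear_for *:%R *:%R semidirect_form.
Proof.
split=> [y k a b | b k y z]; rewrite /semidirect_form -linearP; congr (alpha _);
  congr pair; rewrite /= ?scaler0 ?addr0 //.
  by rewrite add_lfunE scale_lfunE.
by rewrite linearP.
Qed.

(** The bracket of [(b, 0)] with any [(c, y)] is [(0, b y)], so [(b, 0)] lies in the radical. *)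
Lemma semidirect_form_injl b : (forall y, semidirect_form b y = 0) -> b = 0.
Proof.
move=> b0; have /coboundary_nondegenerateP nd := nd_alpha.
suff /(congr1 fst) : ((b, 0) : semidirect_sum abB) = 0 by [].
by apply: nd => -[c y]; rewrite -(b0 y) /lie /= /semidirect_lie /= linear0 subr0.
Qed.

Lemma semidirect_form_injr y : (forall b, semidirect_form b y = 0) -> y = 0.
Proof.
move=> y0; have /coboundary_nondegenerateP nd := nd_alpha.
suff /(congr1 snd) : ((0, y) : semidirect_sum abB) = 0 by [].
apply: nd => -[c z]; rewrite lie_anti linearN -[RHS]oppr0 -(y0 c).
by congr (- alpha _); congr pair; rewrite /= zero_lfunE subr0.
Qed.

End SemidirectPairing.

(** Injectivity of the pairing on each side gives one inequality each. *)
Lemma frobenius_semidirect_dim (R : fieldType) (V : vectType R)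
    (B : {vspace 'End(V)}) (abB : abelian_subalgebra B) :
  frobenius (semidirect_sum abB) -> \dim B = \dim {:V}.
Proof.
case=> alpha nd; have [bl br] := semidirect_form_bilinear alpha.
have flip : bilinear_for *:%R *:%R (fun y b => semidirect_form alpha b y).
  by split.
have := pairing_dim_le flip (semidirect_form_injr nd).
have := pairing_dim_le (conj bl br) (semidirect_form_injl nd).
rewrite [\dim {: subvs_of B}]dimvf /= => le1 le2.
by apply/eqP; rewrite eqn_leq; apply/andP; split.
Qed.

Lemma frobenius_semidirect_masa (R : fieldType) (V : vectType R)
    (B : {vspace 'End(V)}) (abB : abelian_subalgebra B) :
  frobenius (semidirect_sum abB) -> masa B.
Proof.
move=> frobB; have dimB := frobenius_semidirect_dim frobB.
case: frobB => alpha nd; split=> [|c]; first exact: abB.1.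
split=> [Bc b Bb | cB0]; first exact: abB.2.
have [||b fb] := pairing_represent (semidirect_form_bilinear alpha)
  (semidirect_form_injl nd) (g := fun y => alpha (0, c y)).
- by rewrite [LHS]dimvf.
- move=> k x y; rewrite -linearP; congr (alpha _).
  by congr pair; rewrite /= ?scaler0 ?addr0 // linearP.
suff -> : c = vsval b by apply: subvsP.
apply/lfunP=> y; apply/eqP; rewrite -subr_eq0; apply/eqP.
apply: (semidirect_form_injr nd) => a.
have /lie_lfun0P ca := cB0 _ (subvsP a).
have /lie_lfun0P ba := abB.2 _ _ (subvsP b) (subvsP a).
(* Since [c] and [b] commute with [a], the form becomes [alpha] of [(c - b) (a y)], which [fb]
   kills. *)
rewrite /semidirect_form linearB /= -ca -ba.
rewrite [X in alpha X](_ : _ = (0, c (vsval a y)) - (0, vsval b (vsval a y)));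
  last first.
  by congr pair; rewrite /= subrr.
rewrite linearB /=; apply/eqP; rewrite subr_eq0 eq_sym; apply/eqP; exact: fb.
Qed.

(** * Units of a MASA *)

Lemma exists_nonroot (R : numFieldType) (p : {poly R}) :
  p != 0 -> exists t, ~~ root p t.
Proof.
(* [size p] exceeds the degree by one, so these points, distinct in characteristic zero, cannot all
   be roots. *)
move=> p0; set s := [seq i%:R | i <- iota 0 (size p)] : seq R.
have s_uniq : uniq s.
  by rewrite map_inj_uniq ?iota_uniq // => i j /eqP; rewrite eqr_nat => /eqP.
case: (boolP (all (root p) s)) => [s_root | /allPn[t _ nt]]; last by exists t.
by have := max_poly_roots p0 s_root s_uniq; rewrite size_map size_iota ltnn.
Qed.

(** Only eigenvalues of [b] are excluded: a nonroot [t] of the characteristic polynomial leaves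
    [b - t] with zero kernel. *)
Lemma exists_invertible_shift (R : numFieldType) (V : vectType R) (b : 'End(V)) :
  exists t : R, invertible_lfun (b - t *: \1%VF).
Proof.
have e_basis := vbasisP {:V}; set M := mxof (vbasis {:V}) (vbasis {:V}) b.
have [t nt] := exists_nonroot (monic_neq0 (char_poly_monic M)).
exists t; suff ker0 : lker (b - t *: \1%VF) == 0%VS.
  by rewrite /invertible_lfun /= lker0_compfV // lker0_compVf // !eqxx.
rewrite -[lker _]/(leigenspace b t) (leigenspaceE e_basis) vsof_eq0 //.
by rewrite -[_ == 0]negbK -/(eigenvalue M t) eigenvalue_root_char.
Qed.

Lemma masa_units_maximal (R : numFieldType) (V : vectType R)
    (B : {vspace 'End(V)}) :
  masa B -> maximal_abelian_subgroup (units_of B).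
Proof.
(* The identity centralizes [B], hence lies in it; so do the scalar shifts of elements of [B]. *)
move=> [_ cB]; have B1 : \1%VF \in B.
  by apply/cB=> b _; apply/lie_lfun0P=> x; rewrite !id_lfunE.
split=> [|T [_ abT] sBT g]; first split; first split=> //.
(* The quotient of [u] by [v] stays in [B] because [v^-1] commutes with whatever [v] commutes
   with. *)
- move=> u v Bu Bv; apply/cB=> b Bb; apply/lie_lfun0P=> x.
  have /lie_lfun0P ub := (cB (lfunGL_val u)).1 Bu b Bb.
  have /lie_lfun0P vb := (cB (lfunGL_val v)).1 Bv b Bb.
  have /andP[/eqP vV /eqP Vv] := lfunGL_subproof v.
  have vK y : (v^-1)%VF (lfunGL_val v y) = y by rewrite -comp_lfunE Vv id_lfunE.
  have Kv y : lfunGL_val v ((v^-1)%VF y) = y by rewrite -comp_lfunE vV id_lfunE.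
  by rewrite /= !comp_lfunE -ub; congr (lfunGL_val u _); rewrite -{1}[x]Kv -vb vK.
- move=> u v Bu Bv; apply/val_inj/lfunP=> x /=.
  have /lie_lfun0P uv := (cB (lfunGL_val u)).1 Bu _ Bv.
  by rewrite !comp_lfunE uv.
- apply/idP/idP=> [Tg | /sBT //]; apply/cB=> b Bb.
  (* [b] may be singular, but its shift is a unit of [B], hence in [T]; commuting with the shift is
     commuting with [b]. *)
  have [t inv_bt] := exists_invertible_shift b.
  have Tbt : LfunGL inv_bt \in T.
    by apply: sBT; rewrite inE /= memvB // memvZ.
  have /(congr1 val)/lfunP gbt := abT _ _ Tg Tbt.
  apply/lie_lfun0P=> x; have := gbt x.
  rewrite /= !comp_lfunE /= !(add_lfunE, opp_lfunE, scale_lfunE, id_lfunE).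
  by rewrite linearB linearZ /= => /addIr.
Qed.

(** * The adjoint action on the derived ideal *)

Section TwoSolvable.
Variables (R : fieldType) (G : lieAlgType R).
Hypothesis solvG : two_solvable G.
Local Notation D := (derived_ideal G).

Lemma lie_derived (u v : G) : lie u v \in D.
Proof. by have /lie_prodvP := subvv D; apply; rewrite memvf. Qed.

Lemma jacobi_derivation (u v w : G) :
  lie u (lie v w) = lie (lie u v) w + lie v (lie u w).
Proof.
have := lie_jacobi u v w.
rewrite (lie_anti w u) (lie_anti w) linearNr /= => /eqP.
by rewrite -addrA -opprD subr_eq0 addrC => /eqP.
Qed.

HB.instance Definition _ (u : G) :=
  GRing.isLinear.Build R G G *:%R (lie u) ((@lie_bilinear R G).2 u).

(** All brackets lie in [D], so [vsproj] changes only the type, not the value. *)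
Definition ad_derived (u : G) : 'End(subvs_of D) :=
  linfun (vsproj D \o lie u \o vsval).

Lemma ad_derivedE u x : vsval (ad_derived u x) = lie u (vsval x).
Proof. by rewrite lfunE /= vsprojK // lie_derived. Qed.

Lemma ad_derived_linear : linear ad_derived.
Proof.
move=> a u v; apply/lfunP=> x; apply/val_inj.
by rewrite add_lfunE scale_lfunE /= !ad_derivedE linearPl.
Qed.

HB.instance Definition _ :=
  GRing.isLinear.Build R G 'End(subvs_of D) *:%R ad_derived ad_derived_linear.

Definition derived_operators : {vspace 'End(subvs_of D)} :=
  limg (linfun ad_derived).

Lemma mem_derived_operators u : ad_derived u \in derived_operators.
Proof. by rewrite -(lfunE ad_derived u) memv_img // memvf. Qed.

(** The two sides differ by [[[u, v], x]], a bracket of two elements of the Abelian [D]. *)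
Lemma ad_derivedC u v x :
  ad_derived u (ad_derived v x) = ad_derived v (ad_derived u x).
Proof.
apply/val_inj; rewrite /= !ad_derivedE jacobi_derivation solvG ?add0r //.
  exact: lie_derived.
exact: subvsP.
Qed.

Lemma derived_operators_abelian : abelian_subalgebra derived_operators.
Proof.
have ab : lie_abelian derived_operators.
  move=> _ _ /memv_imgP[u _ ->] /memv_imgP[v _ ->].
  by rewrite !lfunE; apply/lie_lfun0P => x; apply: ad_derivedC.
by split=> // a b Ba Bb; rewrite ab // mem0v.
Qed.

Local Notation BV := (semidirect_sum derived_operators_abelian).

(** * The isomorphism defined by a principal element *)

Section PrincipalElement.
Variables (alpha : 'Hom(G, R^o)) (e : G).
Hypotheses (nd_alpha : nondegenerate (coboundary alpha))
           (alpha_e : forall x, alpha (lie e x) = alpha x).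

Lemma lie_principal x : x \in D -> lie e x = x.
Proof.
move=> Dx; have /coboundary_nondegenerateP nd := nd_alpha.
apply/eqP; rewrite -subr_eq0; apply/eqP/nd => a.
(* In [[a, [e, x]] = [[a, e], x] + [e, [a, x]]] the first term is a bracket within [D], and [alpha]
   takes the same value on the second as on [[a, x]]. *)
rewrite lie_anti linearN linearBr linearB /= jacobi_derivation.
by rewrite solvG ?lie_derived // add0r alpha_e subrr oppr0.
Qed.

Definition to_semidirect (u : G) : BV :=
  (vsproj derived_operators (ad_derived u), vsproj D (lie e u)).

Lemma to_semidirect_linear : linear to_semidirect.
Proof. by move=> a u v; rewrite /to_semidirect !linearP. Qed.

HB.instance Definition _ :=
  GRing.isLinear.Build R G BV *:%R to_semidirect to_semidirect_linear.

(** If [ad u] vanishes on [D] and [[e, u] = 0], then [alpha [u, v] = alpha [e, [u, v]] = alpha [u,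
    [e, v]] = 0] for all [v]. *)
Lemma to_semidirect_inj : injective to_semidirect.
Proof.
apply: raddf_inj => u [] /(congr1 vsval).
rewrite vsprojK ?mem_derived_operators //= => ad0 /(congr1 vsval).
rewrite vsprojK ?lie_derived //= => eu0.
have /coboundary_nondegenerateP nd := nd_alpha; apply: nd => v.
rewrite -alpha_e jacobi_derivation eu0 linear0l add0r.
rewrite -[lie e v](vsprojK (lie_derived e v)) -ad_derivedE ad0.
by rewrite zero_lfunE linear0.
Qed.

(* A preimage of (ad u, d): since ad e is a projection onto D, u - [e, u] is
   killed by ad e, while [e, u] and d act trivially on D. *)
Lemma to_semidirect_surj p : exists u, to_semidirect u = p.
Proof.
case: p => b d; have /memv_imgP[u _ bE] := subvsP b.
rewrite lfunE /= in bE; exists (u - lie e u + vsval d).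
have eE x : x \in D -> lie e x = x := @lie_principal x.
congr pair; apply/val_inj; rewrite /= vsprojK ?lie_derived ?mem_derived_operators //.
  rewrite bE; apply/lfunP=> x; apply/val_inj; rewrite /= !ad_derivedE.
  rewrite linearDl linearBl /=.
  rewrite (solvG (lie_derived e u)) ?subvsP // (solvG (subvsP d)) ?subvsP //.
  by rewrite subr0 addr0.
rewrite linearDr linearBr /= (eE (lie e u)) ?lie_derived // subrr add0r.
by rewrite eE ?subvsP.
Qed.

(** [[u, v]] acts as zero on [D], and the derivation rule for [ad e] gives [[u, [e, v]] - [v,
    [e, u]]], the bracket in the second component. *)
Lemma to_semidirect_lie : {morph to_semidirect : u v / lie u v >-> lie u v}.
Proof.
move=> u v; congr pair; apply/val_inj; rewrite /=.
  rewrite vsprojK ?mem_derived_operators //; apply/lfunP=> x; apply/val_inj.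
  by rewrite /= ad_derivedE zero_lfunE /= solvG ?lie_derived ?subvsP.
rewrite vsprojK ?lie_derived // !vsprojK ?mem_derived_operators //.
rewrite !ad_derivedE !vsprojK ?lie_derived //.
by rewrite jacobi_derivation (lie_anti (lie e u) v) addrC.
Qed.

Lemma to_semidirect_iso : lie_isomorphic G BV.
Proof.
exists to_semidirect; split; last exact: to_semidirect_lie.
have ker0 : lker (linfun to_semidirect) == 0%VS.
  by apply/lker0P=> u v; rewrite !lfunE; apply: to_semidirect_inj.
exists (linfun to_semidirect)^-1%VF => [u | p].
  by rewrite -{1}(lfunE to_semidirect u) lker0_lfunK.
have [u <-] := to_semidirect_surj p.
by rewrite -{1}(lfunE to_semidirect u) lker0_lfunK.
Qed.

End PrincipalElement.

Lemma two_solvable_frobenius_iso : frobenius G -> lie_isomorphic G BV.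
Proof.
case=> alpha nd; have [e alpha_e] := frobenius_represent nd (linearP alpha).
exact: to_semidirect_iso nd alpha_e.
Qed.

End TwoSolvable.

Theorem theorem1 (R : realType) :
  (forall (n : nat) (V : vectType R) (B : {vspace 'End(V)})
          (abB : abelian_subalgebra B),
     \dim {:V} = n -> \dim B = n ->
     frobenius (semidirect_sum abB) ->
     masa B /\ maximal_abelian_subgroup (units_of B))
  /\
  (forall G : lieAlgType R,
     two_solvable G -> frobenius G ->
     exists (n : nat) (V : vectType R) (B : {vspace 'End(V)})
            (abB : abelian_subalgebra B),
       [/\ \dim {:V} = n, \dim B = n,
           frobenius (semidirect_sum abB)
         & lie_isomorphic G (semidirect_sum abB)]).
Proof.
split=> [n V B abB _ _ frobB | G solvG frobG].
  have masaB := frobenius_semidirect_masa frobB.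
  by split; last exact: masa_units_maximal.
have iso := two_solvable_frobenius_iso solvG frobG.
have frobBV := frobenius_iso iso frobG.
(* Unification takes the derived ideal for [V], [derived_operators] for [B] and the dimension of [V]
   for [n]. *)
do 4 eexists; split; [by [] | | exact: frobBV | exact: iso].
exact: frobenius_semidirect_dim frobBV.
Qed.
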